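(* Let $G$ be an infinite planar group satisfying the ascending and descending chain conditions on subgroups. Then $G$ has no involutions (elements of order $2$).
   Context: For a group $G$, the subgroup graph $\mathcal{L}(G)$ is the graph whose vertices are all subgroups of $G$, two subgroups $H,K$ being adjacent if one of them is a maximal subgroup of the other. $G$ is planar if $\mathcal{L}(G)$ is a planar graph. *)

(* Defs.v *)
From HB Require Import structures.
From mathcomp Require Import all_boot all_order all_algebra.
From mathcomp Require Import all_classical all_reals all_analysis.
From mathcomp Require Import Rstruct Rstruct_topology.
From Stdlib Require Import Rdefinitions.
Set Implicit Arguments. Unset Strict Implicit. Unset Printing Implicit Defensive.
Import Order.TTheory GRing.Theory Num.Theory.
Local Open Scope classical_set_scope.
Local Open Scope ring_scope.

Definition is_group (T : Type) (mul : T -> T -> T) (one : T) (inv : T -> T) : Prop :=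
  [/\ (forall x y z, mul x (mul y z) = mul (mul x y) z),
      (forall x, mul one x = x),
      (forall x, mul x one = x),
      (forall x, mul (inv x) x = one) &
      (forall x, mul x (inv x) = one)].

Definition is_subgroup (T : Type) (mul : T -> T -> T) (one : T) (inv : T -> T)
  (H : set T) : Prop :=
  [/\ H one,
      (forall x y, H x -> H y -> H (mul x y)) &
      (forall x, H x -> H (inv x))].

Definition maximal_subgroup (T : Type) (mul : T -> T -> T) (one : T) (inv : T -> T)
  (H K : set T) : Prop :=
  [/\ is_subgroup mul one inv H, is_subgroup mul one inv K,
      H `<=` K, H <> K &
      (forall L, is_subgroup mul one inv L -> H `<=` L -> L `<=` K -> L = H \/ L = K)].

Definition subgroup_adj (T : Type) (mul : T -> T -> T) (one : T) (inv : T -> T)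
  (H K : set T) : Prop :=
  maximal_subgroup mul one inv H K \/ maximal_subgroup mul one inv K H.

Definition subgroup_ACC (T : Type) (mul : T -> T -> T) (one : T) (inv : T -> T) : Prop :=
  forall Hs : nat -> set T, (forall n, is_subgroup mul one inv (Hs n)) ->
    (forall n, Hs n `<=` Hs n.+1) -> exists N : nat, forall n : nat, leq N n -> Hs n = Hs N.

Definition subgroup_DCC (T : Type) (mul : T -> T -> T) (one : T) (inv : T -> T) : Prop :=
  forall Hs : nat -> set T, (forall n, is_subgroup mul one inv (Hs n)) ->
    (forall n, Hs n.+1 `<=` Hs n) -> exists N : nat, forall n : nat, leq N n -> Hs n = Hs N.

Definition unitI : set R := [set t | 0 <= t <= 1].
Definition unitIo : set R := [set t | 0 < t < 1].

(** A (possibly infinite) graph with vertex set V and symmetric adjacency adj is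
    planar if it can be drawn in the Euclidean plane R^2: vertices go to distinct
    points, each edge {u,v} goes to an arc (continuous injective image of [0,1])
    joining the images of u and v, and arcs meet neither each other nor vertex
    points except at their common endpoints.  The arc of edge {u,v} is
    [arc u v]; [arc v u] is the same arc traversed backwards. *)
Definition planar_graph (U : Type) (V : set U) (adj : U -> U -> Prop) : Prop :=
  exists (p : U -> R * R) (arc : U -> U -> R -> R * R),
  [/\ (forall u v, V u -> V v -> p u = p v -> u = v),
      (forall u v, V u -> V v -> adj u v ->
         [/\ {within unitI, continuous (arc u v)},
             (forall s t, unitI s -> unitI t -> arc u v s = arc u v t -> s = t),
             arc u v 0 = p u, arc u v 1 = p v &
             (forall t, arc v u t = arc u v (1 - t))]),
      (forall u v w, V u -> V v -> V w -> adj u v -> forall t, unitIo t ->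
         arc u v t <> p w) &
      (forall u v u' v', V u -> V v -> V u' -> V v' -> adj u v -> adj u' v' ->
         ~ ((u = u' /\ v = v') \/ (u = v' /\ v = u')) ->
         forall s t, unitIo s -> unitIo t -> arc u v s <> arc u' v' t)].

Definition planar_group (T : Type) (mul : T -> T -> T) (one : T) (inv : T -> T) : Prop :=
  planar_graph (is_subgroup mul one inv) (subgroup_adj mul one inv).

Definition infinite_type (T : Type) : Prop := ~ exists l : list T, forall x, List.In x l.

(* Main.v *)
From Stdlib Require Import Rdefinitions Relations.
Require Import Defs.
From HB Require Import structures.
From mathcomp Require Import all_boot all_order all_algebra.
From mathcomp Require Import all_classical all_reals all_analysis.
From mathcomp Require Import Rstruct Rstruct_topology.
From mathcomp Require Import zify ring lra.

(** Call a subgroup D "outside Frattini" for g when g lies in D but not in some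
    maximal subgroup C of D.  Three pairwise incomparable such subgroups D_i would
    yield a K_{3,3} minor of the subgroup graph: besides the D_i, its vertices are
    the whole group (reached upwards), the cyclic group <g> (reached downwards
    through subgroups containing g) and the trivial group (reached through C_i, by
    subgroups not containing g).  So these subgroups have no antichain of size 3,
    and by both chain conditions there are only finitely many of them.

    If x and y are square roots of z, then C = <z, xy> has index 2 in D = <x, y>
    and misses x; hence every z has finitely many square roots, and, by the
    ascending chain condition along chains of square roots, G has finitely many
    elements of 2-power order.  If g is an involution, then its centralizer is
    infinite because its class is finite.  For y of odd order in the centralizer,
    <y> has index 2 in <y> x <g> and misses g, so there are finitely many such y;
    as each element of the centralizer is the product of one of odd order and one
    of 2-power order, the centralizer is finite, a contradiction.

    That K_{3,3} cannot be drawn with continuous arcs is proved by replacing the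
    arcs by polylines of small mesh and counting modulo 2 the crossings of
    polylines that represent edges without a common endpoint. *)

Set Implicit Arguments. Unset Strict Implicit. Unset Printing Implicit Defensive.
Import Order.TTheory GRing.Theory Num.Theory.
Import numFieldNormedType.Exports.
Local Open Scope classical_set_scope.
Local Open Scope ring_scope.

(** * Crossings of polylines modulo 2 *)

Section Segments.
Variable F : realFieldType.
Implicit Types a b u v : F * F.
Implicit Types e f : (F * F) * (F * F).

Definition lexlt a b := (a.1 < b.1) || ((a.1 == b.1) && (a.2 < b.2)).

(** Twice the signed area of the triangle [a b u]. When [a] lies to the left of [b], it is positive
    exactly if [u] lies above the line [a b]. *)
Definition orient a b u := (b.1 - a.1) * (u.2 - a.2) - (b.2 - a.2) * (u.1 - a.1).

Definition lin a b (s : F) := (a.1 + s * (b.1 - a.1), a.2 + s * (b.2 - a.2)).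

Definition seg_meet e f :=
  exists s t, [/\ 0 <= s <= 1, 0 <= t <= 1 & lin e.1 e.2 s = lin f.1 f.2 t].

(* The vertical direction is tilted infinitesimally, so that the vertical ray
   issued from [u] never runs along a segment nor through an endpoint. *)
Definition below u e :=
  if lexlt e.1 e.2 then [&& lexlt e.1 u, lexlt u e.2 & 0 < orient e.1 e.2 u]
  else [&& lexlt e.2 u, lexlt u e.1 & 0 < orient e.2 e.1 u].

(** For distinct endpoints this is the parity of the endpoints of [f] between those of [e]: true
    when the shadows of the segments overlap without nesting. *)
Definition interlace e f :=
  (lexlt e.1 f.1 (+) lexlt e.2 f.1) (+) (lexlt e.1 f.2 (+) lexlt e.2 f.2).

Lemma lexlt_irr a : lexlt a a = false.
Proof. by rewrite /lexlt ltxx eqxx ltxx. Qed.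

Lemma lexlt_trans b a c : lexlt a b -> lexlt b c -> lexlt a c.
Proof.
rewrite /lexlt => /orP[ab|/andP[/eqP-> ab]] /orP[bc|/andP[/eqP<- bc]].
- by rewrite (lt_trans ab bc).
- by rewrite ab.
- by rewrite bc.
- by rewrite eqxx (lt_trans ab bc) orbT.
Qed.

Lemma lexlt_le a b : lexlt a b -> a.1 <= b.1.
Proof. by case/orP => [/ltW|/andP[/eqP-> _]]. Qed.

Lemma lexlt_total a b : [\/ lexlt a b, a = b | lexlt b a].
Proof.
case: a b => [a1 a2] [b1 b2]; rewrite /lexlt /=.
case: (ltgtP a1 b1) => [_|_|->]; [by constructor 1|by constructor 3|].
by case: (ltgtP a2 b2) => [_|_|->]; [constructor 1|constructor 3|constructor 2].
Qed.

Lemma lexlt_asym a b : lexlt a b -> lexlt b a = false.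
Proof.
by move=> ab; apply/negP => ba; move: (lexlt_trans ab ba); rewrite lexlt_irr.
Qed.

Lemma lexlt_neg a b : a != b -> lexlt b a = ~~ lexlt a b.
Proof.
case: (lexlt_total a b) => [ab|->|ba] ne; first by rewrite ab lexlt_asym.
  by rewrite eqxx in ne.
by rewrite ba lexlt_asym.
Qed.

Lemma seg_meetC e f : seg_meet e f -> seg_meet f e.
Proof. by move=> [s [t [? ? E]]]; exists t, s; split. Qed.

Lemma seg_meet_revl a b f : seg_meet (a, b) f -> seg_meet (b, a) f.
Proof.
move=> [s [t [hs ht E]]]; exists (1 - s), t; split=> //; first by lra.
by rewrite -E /lin /=; congr pair; ring.
Qed.

(** [orient a b] is affine along [u v] and stops being positive there, so it vanishes at the
    parameter [p / (p + q)]. *)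
Lemma seg_meet_nested a b u v : lexlt a u -> lexlt u b -> lexlt a v ->
  lexlt v b -> 0 < orient a b u -> orient a b v <= 0 -> seg_meet (a, b) (u, v).
Proof.
move=> au ub av vb P Q.
have := lexlt_le au; have := lexlt_le ub; have := lexlt_le av; have := lexlt_le vb.
move=> vb1 av1 ub1 au1.
have ab : a.1 < b.1.
  rewrite lt_neqAle (le_trans au1 ub1) andbT; apply/eqP => E.
  have Eu : u.1 = a.1 by apply/eqP; rewrite eq_le au1 E ub1.
  by move: P; rewrite /orient Eu E !subrr mul0r mulr0 subrr ltxx.
pose p := orient a b u; pose q := - orient a b v.
have q0 : 0 <= q by rewrite oppr_ge0.
have pq : 0 < p + q by exact: ltr_wpDr.
have [t [t0 t1 tE]] : exists t, [/\ 0 <= t, t <= 1 & t * (p + q) = p].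
  exists (p / (p + q)); split; first by rewrite divr_ge0 // ltW.
    by rewrite ler_pdivrMr // mul1r lerDl.
  by rewrite mulfVK // gt_eqF.
have d0 : 0 < b.1 - a.1 by lra.
exists ((u.1 + t * (v.1 - u.1) - a.1) / (b.1 - a.1)), t; split.
- rewrite divr_ge0 /= ?ler_pdivrMr ?mul1r; [|nra..].
  nra.
- by rewrite t0 t1.
- rewrite /lin /=; congr pair; first by field; lra.
  apply: (mulIf (lt0r_neq0 d0)); move: tE; rewrite /p /q /orient => tE.
  by rewrite mulrDl mulrAC mulfVK ?lt0r_neq0 //; lra.
Qed.

(** Over the common shadow, from [u] to [b], the height of [u v] above [a b] starts with the sign of
    [orient a b u] and ends with the sign of [- orient u v b]; the hypothesis makes it vanish in
    between. *)
Lemma seg_meet_interlaced a b u v : lexlt a u -> lexlt u b -> lexlt b v ->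
  (0 < orient a b u) = (0 < orient u v b) -> seg_meet (a, b) (u, v).
Proof.
move=> au ub bv PQ.
have := lexlt_le au; have := lexlt_le ub; have := lexlt_le bv.
move=> bv1 ub1 au1.
have [ab|] := ltP a.1 b.1; last first.
  move=> ba; have eu : u.1 = a.1 by apply/eqP; rewrite eq_le au1 (le_trans ub1).
  have eb : b.1 = a.1 by apply/eqP; rewrite eq_le ba -eu ub1.
  move: au ub; rewrite /lexlt eu eb eqxx ltxx /= => au ub.
  exists ((u.2 - a.2) / (b.2 - a.2)), 0; split; rewrite ?lexx ?ler01 //.
    by rewrite divr_ge0 /= ?ler_pdivrMr ?mul1r; lra.
  by rewrite /lin /= eu eb; congr pair; field; lra.
have [uv|] := ltP u.1 v.1; last first.
  move=> vu; have eb : b.1 = u.1 by apply/eqP; rewrite eq_le ub1 (le_trans bv1).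
  have ev : v.1 = u.1 by apply/eqP; rewrite eq_le vu -eb bv1.
  move: ub bv; rewrite /lexlt eb ev eqxx ltxx /= => ub bv.
  exists 1, ((b.2 - u.2) / (v.2 - u.2)); split; rewrite ?lexx ?ler01 //.
    by rewrite divr_ge0 /= ?ler_pdivrMr ?mul1r; lra.
  by rewrite /lin /= eb ev; congr pair; field; lra.
have d0 : 0 < b.1 - a.1 by lra.
have e0 : 0 < v.1 - u.1 by lra.
(* If the sum is zero, both terms vanish, so [u] itself lies on [a b]. *)
have [P0|P0] := eqVneq (orient a b u * (v.1 - u.1) + orient u v b * (b.1 - a.1)) 0.
  have {}P0 : orient a b u = 0.
    by move: PQ; case: ltP => h1; case: ltP => h2 // _; nra.
  exists ((u.1 - a.1) / (b.1 - a.1)), 0; split; rewrite ?lexx ?ler01 //.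
    by rewrite divr_ge0 /= ?ler_pdivrMr ?mul1r; lra.
  rewrite /lin /=; congr pair; first by field; lra.
  apply: (mulIf (lt0r_neq0 d0)); rewrite mulrDl mulrAC mulfVK ?lt0r_neq0 //.
  by move: P0; rewrite /orient; lra.
pose D := orient a b u * (v.1 - u.1) + orient u v b * (b.1 - a.1).
(* [t] is the position in the common shadow where the linearly interpolated height difference
   vanishes. *)
have [t [t01 tE]] : exists t, 0 <= t <= 1 /\ t * D = orient a b u * (v.1 - u.1).
  exists (orient a b u * (v.1 - u.1) / D); split; last by rewrite mulfVK.
  move: PQ; case: ltP => h1; case: ltP => h2 // _.
    have D0 : 0 < D by rewrite /D; nra.
    by rewrite divr_ge0 /= ?ler_pdivrMr ?mul1r ?/D; nra.
  have D0 : 0 < - D.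
    by rewrite oppr_gt0 lt_neqAle P0 /D /=; nra.
  rewrite -[_ / D]opprK -mulrN -invrN -mulNr.
  by rewrite divr_ge0 /= ?ler_pdivrMr ?mul1r ?/D; nra.
pose x := u.1 + t * (b.1 - u.1).
have x1 : u.1 <= x by rewrite /x; nra.
have x2 : x <= b.1 by rewrite /x; nra.
exists ((x - a.1) / (b.1 - a.1)), ((x - u.1) / (v.1 - u.1)); split.
- by rewrite divr_ge0 /= ?ler_pdivrMr ?mul1r; lra.
- by rewrite divr_ge0 /= ?ler_pdivrMr ?mul1r; lra.
- rewrite /lin /=; congr pair; first by field; lra.
  apply: (mulIf (lt0r_neq0 d0)); apply: (mulIf (lt0r_neq0 e0)).
  transitivity ((a.2 * (b.1 - a.1) + (x - a.1) * (b.2 - a.2)) * (v.1 - u.1)).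
    by field; lra.
  transitivity ((u.2 * (v.1 - u.1) + (x - u.1) * (v.2 - u.2)) * (b.1 - a.1));
    last by field; lra.
  by move: tE; rewrite /x /D /orient => tE; lra.
Qed.

(** For segments in general position this is the parity of their crossings, written as a sum of
    terms attached to endpoints so that it telescopes along polylines. *)
Definition crossing (e f : (F * F) * (F * F)) :=
  ((below f.1 e (+) below f.2 e) (+) (below e.1 f (+) below e.2 f))
  (+) interlace e f.

Lemma crossing_revl a b f : crossing (b, a) f = crossing (a, b) f.
Proof.
have belowC u : below u (b, a) = below u (a, b).
  rewrite /below /=; case: (lexlt_total a b) => [ab|->|ba] //.
    by rewrite ab (lexlt_asym ab).
  by rewrite ba (lexlt_asym ba).
rewrite /crossing /interlace /= !belowC [below b f (+) _]addbC.
by rewrite [lexlt b f.1 (+) _]addbC [lexlt b f.2 (+) _]addbC.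
Qed.

Lemma seg_meet_endpoint e f : [\/ e.1 = f.1, e.1 = f.2, e.2 = f.1 | e.2 = f.2] ->
  seg_meet e f.
Proof.
have start e' f' : e'.1 = f'.1 -> seg_meet e' f'.
  move=> E; exists 0, 0; split; rewrite ?lexx ?ler01 //.
  by rewrite /lin !mul0r !addr0 E.
case: e f => [a b] [u v] [] /= E.
- exact: start.
- by apply/seg_meetC/seg_meet_revl/seg_meetC/start.
- by apply/seg_meet_revl/start.
- by apply/seg_meet_revl/seg_meetC/seg_meet_revl/start.
Qed.

(** Only [interlace] is not visibly symmetric. As the endpoints differ, the exchange negates its
    four comparisons, and the negations cancel. *)
Lemma crossingC e f : ~ seg_meet e f -> crossing e f = crossing f e.
Proof.
move=> ndis.
have n11 : e.1 != f.1.
  by apply/eqP => E; apply: ndis; apply: seg_meet_endpoint; constructor 1.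
have n12 : e.1 != f.2.
  by apply/eqP => E; apply: ndis; apply: seg_meet_endpoint; constructor 2.
have n21 : e.2 != f.1.
  by apply/eqP => E; apply: ndis; apply: seg_meet_endpoint; constructor 3.
have n22 : e.2 != f.2.
  by apply/eqP => E; apply: ndis; apply: seg_meet_endpoint; constructor 4.
rewrite /crossing [X in X (+) _ = _]addbC; congr (_ (+) _).
rewrite /interlace (lexlt_neg n11) (lexlt_neg n12) (lexlt_neg n21) (lexlt_neg n22).
by case: lexlt; case: lexlt; case: lexlt; case: lexlt.
Qed.

(** Reversals and exchange reduce to [a] leftmost with both segments oriented rightwards. The
    shadows are then apart, interlaced or nested, and the last two cases are the two meeting
    lemmas. *)
Lemma crossing_disjoint e f : ~ seg_meet e f -> crossing e f = false.
Proof.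
have degenerate a f' : crossing (a, a) f' = false.
  have bd u : below u (a, a) = false.
    rewrite /below /= lexlt_irr; case: (lexlt_total a u) => [h|<-|h];
    by rewrite ?lexlt_irr // (lexlt_asym h) ?andbF.
  by rewrite /crossing /interlace !bd !addbb.
have wlog_case a b u v : lexlt a b -> lexlt u v -> lexlt a u ->
    ~ seg_meet (a, b) (u, v) -> crossing (a, b) (u, v) = false.
  move=> ab uv au ndis; have av := lexlt_trans au uv.
  rewrite /crossing /interlace /below /= ab uv au av !(lexlt_asym au) /=.
  case: (lexlt_total b u) => [bu|bu|ub].
  - have bv := lexlt_trans bu uv.
    by rewrite bu bv !(lexlt_asym bu) (lexlt_asym bv).
  - by case: ndis; apply: seg_meet_endpoint; constructor 3.
  rewrite ub (lexlt_asym ub) /=.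
  case: (lexlt_total b v) => [bv|bv|vb].
  - rewrite bv (lexlt_asym bv) /= addbF.
    have: (0 < orient a b u) <> (0 < orient u v b).
      by move=> E; apply: ndis; apply: seg_meet_interlaced.
    by case: (0 < _); case: (0 < _).
  - by case: ndis; apply: seg_meet_endpoint; constructor 4.
  rewrite vb (lexlt_asym vb) /= !addbF.
  case: ltP => [Pu|Pu]; case: ltP => [Pv|Pv] //; exfalso; apply: ndis.
    by apply: seg_meet_nested.
  apply: seg_meetC; apply: seg_meet_revl; apply: seg_meetC.
  by apply: seg_meet_nested.
have sorted_case a b u v : lexlt a b -> lexlt u v ->
    ~ seg_meet (a, b) (u, v) -> crossing (a, b) (u, v) = false.
  move=> ab uv ndis; case: (lexlt_total a u) => [au|au|ua].
  - exact: wlog_case.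
  - by case: ndis; apply: seg_meet_endpoint; constructor 1.
  by rewrite crossingC //; apply: wlog_case => // /seg_meetC.
have left_sorted a b g : lexlt a b -> ~ seg_meet (a, b) g ->
    crossing (a, b) g = false.
  case: g => u v ab ndis; case: (lexlt_total u v) => [uv|uv|vu].
  - exact: sorted_case.
  - by subst v; rewrite crossingC.
  - have ndis' : ~ seg_meet (a, b) (v, u).
      by move=> /seg_meetC/seg_meet_revl/seg_meetC.
    rewrite crossingC // crossing_revl crossingC; last by move=> /seg_meetC.
    exact: sorted_case.
case: e => a b ndis; case: (lexlt_total a b) => [ab|ab|ba].
- exact: left_sorted.
- by subst b; exact: degenerate.
- by rewrite crossing_revl; apply: left_sorted => // /seg_meet_revl.
Qed.

(** * Polylines *)

Definition segments (x : F * F) (s : seq (F * F)) := zip (x :: s) s.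

Lemma segments_telescope (g : F * F -> bool) x s :
  \big[addb/false]_(e <- segments x s) (g e.1 (+) g e.2) = g x (+) g (last x s).
Proof.
elim: s x => [|y s IH] x; first by rewrite /segments /= big_nil addbb.
rewrite /segments /= big_cons /= -/(segments y s) IH.
by rewrite addbA -[_ (+) g y (+) g y]addbA addbb addbF.
Qed.

Definition below_poly u x s := \big[addb/false]_(e <- segments x s) below u e.

(** The crossings of all pairs of segments vanish, and so does their sum. The ray terms telescope
    along one polyline, the [interlace] terms along both. *)
Lemma polylines_crossing x s y r :
  {in segments x s & segments y r, forall e f, ~ seg_meet e f} ->
  ((below_poly y x s (+) below_poly (last y r) x s)
   (+) (below_poly x y r (+) below_poly (last x s) y r))
  (+) interlace (x, last x s) (y, last y r) = false.
Proof.
move=> dis.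
have: \big[addb/false]_(e <- segments x s) \big[addb/false]_(f <- segments y r)
   crossing e f = false.
  rewrite big_seq big1 // => e he; rewrite big_seq big1 // => f hf.
  by apply: crossing_disjoint; apply: dis.
pose X e f := below f.1 e (+) below f.2 e.
move=> <-; transitivity
  ((\big[addb/false]_(e <- segments x s) \big[addb/false]_(f <- segments y r) X e f)
   (+) (\big[addb/false]_(e <- segments x s) \big[addb/false]_(f <- segments y r) X f e)
   (+) (\big[addb/false]_(e <- segments x s) \big[addb/false]_(f <- segments y r)
          interlace e f)); last first.
  by rewrite -!big_split; apply: eq_bigr => e _; rewrite -!big_split.
congr (_ (+) _ (+) _).
- rewrite /below_poly -big_split; apply: eq_bigr => e _.
  by rewrite (segments_telescope (fun u => below u e)).
- rewrite exchange_big /below_poly -big_split; apply: eq_bigr => f _.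
  by rewrite (segments_telescope (fun u => below u f)).
- rewrite /interlace /=; under [RHS]eq_bigr => e _.
    rewrite (segments_telescope (fun p => lexlt e.1 p (+) lexlt e.2 p)); over.
  rewrite big_split /= (segments_telescope (fun q => lexlt q y)).
  by rewrite (segments_telescope (fun q => lexlt q (last y r))).
Qed.

(** [S m] counts the hits of rays from each [b j] on the polylines from [a m] to the other two
    [b l]. Adding [polylines_crossing] over the six ordered pairs [j != l], every term besides [S i]
    and [S k] occurs an even number of times, except the comparisons of [b j] with [b l], of which
    exactly three hold. So [S 0], [S 1], [S 2] would be three pairwise different booleans. *)
Lemma K33_polylines (a b : 'I_3 -> F * F) (s : 'I_3 -> 'I_3 -> seq (F * F)) :
  (forall i j, last (a i) (s i j) = b j) ->
  (forall i j k l, i != k -> j != l ->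
    {in segments (a i) (s i j) & segments (a k) (s k l),
       forall e f, ~ seg_meet e f}) ->
  injective b -> False.
Proof.
move=> lastE dis binj.
pose o0 : 'I_3 := @Ordinal 3 0 isT.
pose o1 : 'I_3 := @Ordinal 3 1 isT.
pose o2 : 'I_3 := @Ordinal 3 2 isT.
pose B m j l := below_poly (b j) (a m) (s m l).
pose S m := (B m o0 o1 (+) B m o0 o2) (+) (B m o1 o0 (+) B m o1 o2)
  (+) (B m o2 o0 (+) B m o2 o1).
have key (i k : 'I_3) : i != k -> S i (+) S k = true.
  move=> ik.
  have H j l : j != l -> _ := fun jl => polylines_crossing (dis i j k l ik jl).
  have {}H j l : j != l ->
    (((below_poly (a k) (a i) (s i j) (+) below_poly (b l) (a i) (s i j))
     (+) (below_poly (a i) (a k) (s k l) (+) below_poly (b j) (a k) (s k l)))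
    (+) interlace (a i, b j) (a k, b l)) = false.
    by move=> jl; have := H j l jl; rewrite !lastE.
  pose f j := below_poly (a k) (a i) (s i j) (+) lexlt (b j) (a k).
  pose g l := below_poly (a i) (a k) (s k l) (+) lexlt (a i) (b l).
  have {}H j l : j != l -> B i l j (+) B k j l =
      f j (+) g l (+) lexlt (a i) (a k) (+) lexlt (b j) (b l).
    move=> /H; rewrite /interlace /= /B /f /g.
    case: (below_poly (a k) _ _); case: (below_poly (b l) _ _);
    case: (below_poly (a i) _ _); case: (below_poly (b j) _ _);
    by case: (lexlt (a i) (a k)); case: (lexlt (b j) (a k));
       case: (lexlt (a i) (b l)); case: (lexlt (b j) (b l)).
  have n01 : b o0 != b o1 by apply/eqP => /binj.
  have n02 : b o0 != b o2 by apply/eqP => /binj.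
  have n12 : b o1 != b o2 by apply/eqP => /binj.
  have -> : S i (+) S k = (B i o1 o0 (+) B k o0 o1) (+) (B i o0 o1 (+) B k o1 o0)
      (+) ((B i o2 o0 (+) B k o0 o2) (+) (B i o0 o2 (+) B k o2 o0))
      (+) ((B i o2 o1 (+) B k o1 o2) (+) (B i o1 o2 (+) B k o2 o1)).
    by rewrite /S -!addbA; do !bool_congr.
  rewrite !H // (lexlt_neg n01) (lexlt_neg n02) (lexlt_neg n12).
  case: (f o0); case: (f o1); case: (f o2); case: (g o0); case: (g o1);
  by case: (g o2); case: (lexlt (a i) (a k)); case: lexlt; case: lexlt; case: lexlt.
have := key o0 o1 isT; have := key o0 o2 isT; have := key o1 o2 isT.
by case: (S o0); case: (S o1); case: (S o2).
Qed.
End Segments.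

(** * Drawings of K33 *)

Section Chains.
Variable R : realType.
Implicit Types (K L : set (R * R)) (x y : R * R) (d : R).

Definition step K d : rel (R * R) := fun x y =>
  [&& `[< K x >], `[< K y >] & `|x - y| <= d].

Definition chained K d := clos_refl_sym_trans _ (fun x y => step K d x y).

Lemma step_sym K d : symmetric (step K d).
Proof. by move=> x y; rewrite /step distrC andbCA. Qed.

Lemma chained_path K d x y : chained K d x y ->
  exists2 s, path (step K d) x s & last x s = y.
Proof.
elim=> {x y} [x y xy|x|x y _ [s ps <-]|x y z _ [s ps <-] _ [r pr <-]].
- by exists [:: y]; rewrite //= xy.
- by exists [::].
- exists (rev (belast x s)).
    by rewrite rev_path (eq_path (e' := step K d)) // => u v; exact: step_sym.
  by case: s {ps} => //= z s; rewrite rev_cons last_rcons.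
- by exists (s ++ r); rewrite ?cat_path ?ps ?last_cat.
Qed.

Lemma chainedW K L d x y : K `<=` L -> chained K d x y -> chained L d x y.
Proof.
move=> KL; elim=> {x y} [x y /and3P[/asboolP Kx /asboolP Ky xy]|x|x y _ h|x y z _ h _ h'].
- by apply: rst_step; rewrite /step xy !andbT; apply/andP; split;
     apply/asboolP; apply: KL.
- exact: rst_refl.
- exact: rst_sym.
- exact: rst_trans h h'.
Qed.

(** Continuous induction: the supremum of the parameters reachable from 0 is itself reachable by
    continuity, and could be exceeded if it were below 1. *)
Lemma arc_chained (f : R -> R * R) d : 0 < d ->
  {within [set t | 0 <= t <= 1], continuous f} ->
  chained (f @` [set t | 0 <= t <= 1]) d (f 0) (f 1).
Proof.
move=> d0 /subspace_continuousP fcont.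
pose I : set R := [set t | 0 <= t <= 1].
pose E : set R := [set t | I t /\ chained (f @` I) d (f 0) (f t)].
have E0 : E 0 by split; [rewrite /I /= lexx ler01 | exact: rst_refl].
have ubE : has_ubound E by exists 1 => t [/andP[]].
have hsE : has_sup E by split=> //; exists 0.
set c := sup E.
have c0 : 0 <= c by exact: ub_le_sup.
have c1 : c <= 1 by apply: ge_sup; [exists 0 | move=> t [/andP[]]].
have Ic : I c by rewrite /I /= c0.
have [e /= e0 He] : exists2 e : R, 0 < e &
    forall t, I t -> `|c - t| < e -> `|f c - f t| <= d.
  have /cvgrPdist_le/(_ d d0) := fcont c Ic.
  rewrite near_withinE => /nbhs_ballP[e /= e0 He]; exists e => // t It ct.
  exact: He.
have link t u : E t -> I u -> `|f t - f u| <= d -> E u.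
  move=> [It ch] Iu tu; split=> //; apply: rst_trans ch _; apply: rst_step.
  by rewrite /step tu andbT; apply/andP; split; apply/asboolP; [exists t|exists u].
have [t Et ct] := sup_adherent e0 hsE.
have tc : t <= c by exact: ub_le_sup.
have Ec : E c.
  apply: (link t) => //; rewrite distrC; apply: He; first by case: Et.
  by rewrite ger0_norm ?subr_ge0 // ltrBlDr -ltrBlDl.
have [c1'|c1'] := ltP c 1; last first.
  by have c_eq : c = 1 by [apply/eqP; rewrite eq_le c1 c1']; case: Ec; rewrite c_eq.
pose u := Num.min 1 (c + e / 2).
have cu : c < u by rewrite lt_min c1' /=; lra.
have : E u.
  have Iu : I u by rewrite /I /= ge_min lexx andbT; lra.
  apply: (link c) => //; apply: He => //.
  rewrite distrC gtr0_norm ?subr_gt0 //.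
  have : u <= c + e / 2 by rewrite ge_min lexx orbT.
  lra.
by move=> /(ub_le_sup ubE); rewrite leNgt cu.
Qed.

Lemma compact_separated K L : compact K -> compact L -> K `&` L = set0 ->
  exists2 d, 0 < d & forall x y, K x -> L y -> d < `|x - y|.
Proof.
move=> cK cL KL.
have [[z KLz]|/set0P/negP/negPn/eqP KL0] := pselect ((K `*` L) !=set0); last first.
  by exists 1 => // x y Kx Ly; have: (K `*` L) (x, y) by []; rewrite KL0.
have hcont : {within K `*` L, continuous (fun z : (R * R) * (R * R) => `|z.1 - z.2|)}.
  apply: continuous_subspaceT => w.
  apply: cvg_norm; exact: sub_continuous.
have [w /set_mem [Kw Lw] wmin] :=
  compact_EVT_min (ex_intro _ z KLz) (compact_setX cK cL) hcont.
have w0 : 0 < `|w.1 - w.2|.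
  rewrite normr_gt0 subr_eq0; apply/eqP => E.
  by have: (K `&` L) w.1 by [split=> //; rewrite E]; rewrite KL.
exists (`|w.1 - w.2| / 2) => [|x y Kx Ly]; first by lra.
have := wmin (x, y) (mem_set (conj Kx Ly)) => /=; lra.
Qed.

Lemma lin_dist (a b : R * R) s : 0 <= s <= 1 -> `|lin a b s - a| <= `|a - b|.
Proof.
move=> /andP[s0 s1].
have -> : lin a b s - a = s *: (b - a).
  by congr pair; rewrite /= addrAC subrr add0r.
by rewrite normrZ ger0_norm // distrC ler_piMl.
Qed.

(** Each point of a segment is within [d] of its first vertex, so meeting segments would have first
    vertices at distance at most [d + d]. *)
Lemma separated_chains K L d x s y r :
  (forall p q, K p -> L q -> d + d < `|p - q|) ->
  path (step K d) x s -> path (step L d) y r ->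
  {in segments x s & segments y r, forall e f, ~ seg_meet e f}.
Proof.
have path_segments M z l : path (step M d) z l ->
    {in segments z l, forall e, M e.1 /\ `|e.1 - e.2| <= d}.
  elim: l z => [z _ e|u l IH z] /=; first by rewrite /segments in_nil.
  move=> /andP[/and3P[/asboolP Mz _ zu] /IH h] e.
  by rewrite /segments /= inE => /orP[/eqP -> //|/h].
move=> sep /path_segments hK /path_segments hL e f /hK[Ke de] /hL[Lf df].
move=> [t1 [t2 [ht1 ht2 E]]]; have := sep _ _ Ke Lf.
rewrite ltNge => /negP; apply.
apply: le_trans (ler_distD (lin e.1 e.2 t1) _ _) (lerD _ _).
  by rewrite distrC; apply: le_trans (lin_dist _ _ ht1) de.
by rewrite E; apply: le_trans (lin_dist _ _ ht2) df.
Qed.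

End Chains.

(** * Walks in a drawn graph *)

Section Drawings.
Variables (U : Type) (V : set U) (adj : U -> U -> Prop).
Implicit Types (S Q : set U) (u v w : U).

Inductive joined S : U -> U -> Prop :=
| joined_refl u of S u : joined S u u
| joined_edge u v of S u & S v & adj u v : joined S u v
| joined_sym u v of joined S u v : joined S v u
| joined_trans u v w of joined S u v & joined S v w : joined S u w.

Lemma joinedW S Q u v : S `<=` Q -> joined S u v -> joined Q u v.
Proof.
move=> SQ; elim=> {u v} [u Su|u v Su Sv uv|u v _ h|u v w _ h _ h'].
- by apply: joined_refl; exact: SQ.
- by apply: joined_edge => //; exact: SQ.
- exact: joined_sym.
- exact: joined_trans h h'.
Qed.

Lemma joined_in S u v : joined S u v -> S u /\ S v.
Proof. by elim=> {u v} // [u v _ []|u v w _ [? ?] _ []]. Qed.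

Variables (p : U -> R * R) (arc : U -> U -> R -> R * R).

(* The walk is traced in a compact set, so that disjoint walks are at positive
   distance and survive the replacement of arcs by polylines of small mesh. *)
Lemma joined_trace S u v : S `<=` V ->
  (forall u v, V u -> V v -> adj u v ->
     [/\ {within unitI, continuous (arc u v)}, arc u v 0 = p u & arc u v 1 = p v]) ->
  joined S u v ->
  exists K : set (R * R), [/\ compact K,
    (forall x, K x -> (exists2 w, S w & x = p w) \/
       exists w w' t, [/\ S w, S w', adj w w', unitIo t & x = arc w w' t]) &
    forall d, 0 < d -> chained K d (p u) (p v)].
Proof.
move=> SV harc; elim=> {u v} [u Su|u v Su Sv uv|u v _ [K [cK hK ch]]|
    u v w _ [K [cK hK ch]] _ [L [cL hL ch']]].
- exists [set p u]; split=> [|_ ->|d d0]; first exact: compact_set1.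
    by left; exists u.
  exact: rst_refl.
- have [cont a0 a1] := harc u v (SV _ Su) (SV _ Sv) uv.
  exists (arc u v @` unitI); split=> [|_ [t /andP[t0 t1] <-]|d d0].
  + apply: continuous_compact => //.
    have -> : unitI = `[0, 1]%classic by apply/seteqP; split=> t /=; rewrite in_itv.
    exact: segment_compact.
  + move: t0; rewrite le_eqVlt => /orP[/eqP <-|t0]; first by left; exists u.
    move: t1; rewrite le_eqVlt => /orP[/eqP ->|t1]; first by left; exists v.
    by right; exists u, v, t; split=> //; rewrite /unitIo /= t0.
  + by rewrite -a0 -a1; apply: arc_chained.
- by exists K; split=> // d d0; apply: rst_sym; exact: ch.
- exists (K `|` L); split=> [|x [/hK|/hL] //|d d0]; first exact: compactU.
  apply: (@rst_trans _ _ _ (p v)).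
    by apply: chainedW (ch d d0) => x; left.
  by apply: chainedW (ch' d d0) => x; right.
Qed.

End Drawings.

(** Walks sharing an index may overlap freely. This covers [K_{3,3}] minors without extracting a
    subdivision, because the parity argument only compares edges without a common endpoint. *)
Lemma planar_K33 (U : Type) (V : set U) (adj : U -> U -> Prop)
    (a b : 'I_3 -> U) (Q : 'I_3 -> 'I_3 -> set U) :
  planar_graph V adj ->
  (forall i j, Q i j `<=` V) ->
  (forall i j, joined adj (Q i j) (a i) (b j)) ->
  (forall i k j l u, i != k -> j != l -> Q i j u -> ~ Q k l u) -> False.
Proof.
move=> [p [arc [pinj harc hvertex hedge]]] QV hQ dis.
have harc' u v : V u -> V v -> adj u v ->
    [/\ {within unitI, continuous (arc u v)}, arc u v 0 = p u & arc u v 1 = p v].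
  by move=> Vu Vv uv; have [] := harc u v Vu Vv uv.
have trace i j := joined_trace (QV i j) harc' (hQ i j).
have [K hK] := choice (fun ij : 'I_3 * 'I_3 => trace ij.1 ij.2).
have Kdis i j k l : i != k -> j != l -> K (i, j) `&` K (k, l) = set0.
  move=> ik jl; apply/seteqP; split=> // x [].
  have [_ h _] := hK (i, j); have [_ h' _] := hK (k, l).
  have nQ u v : Q i j u -> Q k l v -> u <> v.
    by move=> Qu Qv E; apply: (dis _ _ _ _ u ik jl) => //; rewrite E.
  have VQ := QV i j; have VQ' := QV k l.
  move=> /h /= [[w Qw ->]|[w [w' [t [Qw Qw' ww' t01 ->]]]]].
    move=> /h' /= [[z Qz E]|[z [z' [s [Qz Qz' zz' s01 E]]]]].
      by case: (nQ w z) => //; apply: pinj => //; [exact: VQ|exact: VQ'].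
    by case: (hvertex z z' w (VQ' _ Qz) (VQ' _ Qz') (VQ _ Qw) zz' s s01).
  move=> /h' /= [[z Qz E]|[z [z' [s [Qz Qz' zz' s01 E]]]]].
    by case: (hvertex w w' z (VQ _ Qw) (VQ _ Qw') (VQ' _ Qz) ww' t t01).
  case: (hedge w w' z z' (VQ _ Qw) (VQ _ Qw') (VQ' _ Qz) (VQ' _ Qz') ww' zz' _
    t s t01 s01 E).
  by case=> -[E1 _]; [case: (nQ w z)|case: (nQ w z')].
have [eps eps0 heps] : exists2 eps : R, 0 < eps &
    forall i j k l, i != k -> j != l -> forall x y, K (i, j) x -> K (k, l) y ->
      eps < `|x - y|.
  have sep (ijkl : ('I_3 * 'I_3) * ('I_3 * 'I_3)) : exists eps : R, 0 < eps /\
      (ijkl.1.1 != ijkl.2.1 -> ijkl.1.2 != ijkl.2.2 ->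
       forall x y, K ijkl.1 x -> K ijkl.2 y -> eps < `|x - y|).
    case: ijkl => -[i j] [k l] /=.
    have [ik|] := boolP (i != k); last by exists 1.
    have [jl|] := boolP (j != l); last by exists 1.
    have [cK _ _] := hK (i, j); have [cL _ _] := hK (k, l).
    have [e e0 he] := compact_separated cK cL (Kdis _ _ _ _ ik jl).
    by exists e.
  have [e he] := choice sep.
  exists (\big[Order.min/1]_ijkl e ijkl) => [|i j k l ik jl x y Kx Ky].
    by elim/big_ind: _ => // [u v u0 v0|ijkl _]; [rewrite lt_min u0|case: (he ijkl)].
  apply: le_lt_trans ((he ((i, j), (k, l))).2 ik jl x y Kx Ky).
  by rewrite (bigD1 ((i, j), (k, l))) //= ge_min lexx.
have chain (ij : 'I_3 * 'I_3) : exists s, path (step (K ij) (eps / 2)) (p (a ij.1)) s /\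
    last (p (a ij.1)) s = p (b ij.2).
  have [_ _ /(_ (eps / 2))] := hK ij; rewrite divr_gt0 // => /(_ isT) /chained_path.
  by move=> [s ? ?]; exists s.
have [s hs] := choice chain.
apply: (@K33_polylines _ (p \o a) (p \o b) (fun i j => s (i, j))).
- by move=> i j; case: (hs (i, j)).
- move=> i j k l ik jl.
  have [hp _] := hs (i, j); have [hp' _] := hs (k, l).
  apply: separated_chains hp hp' => x y Kx Ky; rewrite -splitr; exact: heps Kx Ky.
- move=> j l /= E; apply/eqP/negPn/negP => jl.
  (* Walks leaving two different [a i] towards [b j] and [b l] are disjoint, so these ends
     differ. *)
  have [_ Qb] := joined_in (hQ ord0 j); have [_ Qb'] := joined_in (hQ ord_max l).
  have bE : b j = b l by apply: pinj => //; apply: QV; [exact: Qb|exact: Qb'].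
  by apply: (dis ord0 ord_max j l (b j)) => //; rewrite bE.
Qed.

(** * Subgroup graphs *)

(** Dependent choice; it turns the absence of an extremal subgroup into an infinite strict chain. *)
Lemma serial_sequence (T : Type) (P : set T) (r : T -> T -> Prop) x0 : P x0 ->
  (forall x, P x -> exists2 y, P y & r x y) ->
  exists2 s : nat -> T, (forall n, P (s n)) & forall n, r (s n) (s n.+1).
Proof.
move=> Px0 next.
have next' x : exists y, P x -> P y /\ r x y.
  have [/next[y Py xy]|nPx] := pselect (P x); first by exists y.
  by exists x.
have [f hf] := choice next'.
have Ps n : P (iter n f x0) by elim: n => // n /hf [].
by exists (fun n => iter n f x0) => // n; have [] := hf _ (Ps n).
Qed.

Section Groups.
Local Open Scope group_scope.
Variable G : groupType.
Implicit Types (g x y z : G) (H K X Y : set G) (S P : set (set G)).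

Notation sub := (is_subgroup (fun x y : G => x * y) (1 : G) (fun x => x^-1)).
Notation maxsub := (maximal_subgroup (fun x y : G => x * y) 1 (fun x => x^-1)).
Notation adj := (subgroup_adj (fun x y : G => x * y) 1 (fun x => x^-1)).
Notation ACC := (subgroup_ACC (fun x y : G => x * y) 1 (fun x => x^-1)).
Notation DCC := (subgroup_DCC (fun x y : G => x * y) 1 (fun x => x^-1)).
Notation planar := (planar_group (fun x y : G => x * y) 1 (fun x => x^-1)).

(** * Consequences of the chain conditions *)

Lemma ACC_maximal P X : ACC -> (forall Y, P Y -> sub Y) -> P X ->
  exists M, [/\ P M, X `<=` M & forall Y, P Y -> M `<=` Y -> Y = M].
Proof.
move=> acc Psub PX; apply: contrapT => nomax.
have [|Y [PY XY]|s Ps sP] := @serial_sequence _ [set Y | P Y /\ X `<=` Y]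
    (fun Y Z => Y `<=` Z /\ Z <> Y) X.
- by split.
- apply: contrapT => nonext; apply: nomax; exists Y; split=> // Z PZ YZ.
  apply: contrapT => ZY; apply: nonext; exists Z => //.
  by split=> //; exact: subset_trans XY YZ.
- have [|n|N hN] := acc s; first by move=> n; apply: Psub; case: (Ps n).
    by case: (sP n).
  by have [_] := sP N; rewrite (hN N.+1).
Qed.

Lemma DCC_minimal P X : DCC -> (forall Y, P Y -> sub Y) -> P X ->
  exists M, [/\ P M, M `<=` X & forall Y, P Y -> Y `<=` M -> Y = M].
Proof.
move=> dcc Psub PX; apply: contrapT => nomin.
have [|Y [PY XY]|s Ps sP] := @serial_sequence _ [set Y | P Y /\ Y `<=` X]
    (fun Y Z => Z `<=` Y /\ Z <> Y) X.
- by split.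
- apply: contrapT => nonext; apply: nomin; exists Y; split=> // Z PZ YZ.
  apply: contrapT => ZY; apply: nonext; exists Z => //.
  by split=> //; exact: subset_trans YZ XY.
- have [|n|N hN] := dcc s; first by move=> n; apply: Psub; case: (Ps n).
    by case: (sP n).
  by have [_] := sP N; rewrite (hN N.+1).
Qed.

Lemma sub_setT : sub [set: G]. Proof. by split. Qed.

Lemma sub_set1 : sub [set 1].
Proof. by split=> // [x y -> ->|x ->] /=; rewrite ?mul1g ?invg1. Qed.

(** Take a subgroup [X] minimal among those containing infinitely many members of [S]. The maximal
    members properly inside [X] form an antichain, so there are at most two. Each contains finitely
    many members by minimality of [X], and every member properly inside [X] lies in one of them. *)
Lemma finite_width2 S : ACC -> DCC -> (forall X, S X -> sub X) ->
  (forall X : 'I_3 -> set G, (forall i, S (X i)) ->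
     ~ (forall i j, i != j -> ~ X i `<=` X j)) ->
  finite_set S.
Proof.
move=> acc dcc Ssub width; apply: contrapT => Sinf.
have [||X [[Xsub Xinf] _ Xmin]] := @DCC_minimal
    [set X | sub X /\ ~ finite_set [set Y | S Y /\ Y `<=` X]] setT dcc.
- by move=> Y [].
- by split; [exact: sub_setT | apply: contra_not Sinf; apply: sub_finite_set => Y SY].
pose Z := [set Y | [/\ S Y, Y `<=` X & Y <> X]].
pose M := [set Y | Z Y /\ forall Y', Z Y' -> Y `<=` Y' -> Y' = Y].
have Mfin : finite_set M.
  have [->|] := pselect (M = set0); first exact: finite_set0.
  move=> /eqP/set0P[A MA].
  have [|] := pselect (exists B, M B /\ B <> A); last first.
    move=> /forallNP noB; apply: (@sub_finite_set _ _ [set A]) => // B MB.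
    by apply: contrapT => BA; apply: (noB B).
  move=> [B [MB BA]].
  have [|] := pselect (exists C, [/\ M C, C <> A & C <> B]); last first.
    move=> /forallNP noC; apply: (@sub_finite_set _ _ [set A; B]) => // C MC.
    apply: contrapT => /not_orP[CA CB]; exact: (noC C).
  move=> [C [MC CA CB]]; exfalso.
  pose X3 (i : 'I_3) := nth A [:: A; B; C] i.
  have X3M i : M (X3 i) by case: i => [[|[|[|//]]] ?].
  have X3inj i j : i != j -> X3 i <> X3 j.
    case: i j => [[|[|[|//]]] ?] [[|[|[|//]]] ?] //= _; rewrite /X3 /=.
    - by move/esym.
    - by move/esym.
    - by move/esym.
  apply: (width X3) => [i|i j ij XX]; first by have [[]] := X3M i.
  have [_ imax] := X3M i; have [Zj _] := X3M j.
  by apply: (X3inj i j ij); rewrite (imax _ Zj).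
apply: Xinf; apply: (@sub_finite_set _ _
  ([set X] `|` \bigcup_(Y in M) [set Y' | S Y' /\ Y' `<=` Y])).
  move=> Y [SY YX]; have [->|YnX] := pselect (Y = X); first by left.
  right; have [||Y' [ZY' YY' Y'max]] := @ACC_maximal Z Y acc; last by exists Y'.
    by move=> Y' [/Ssub].
  by split.
rewrite finite_setU; split=> //; apply: bigcup_finite => // Y [[SY YX YnX] _].
apply: contrapT => Yinf; apply: YnX; apply: Xmin => //; split=> //; exact: Ssub.
Qed.

(** If [M] is maximal among the subgroups reached from [H] and differs from [K], a minimal [N]
    strictly above [M] has [M] as a maximal subgroup and is reached too. *)
Lemma joined_interval H K : ACC -> DCC -> sub H -> sub K -> H `<=` K ->
  joined adj [set X | [/\ sub X, H `<=` X & X `<=` K]] H K.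
Proof.
move=> acc dcc sH sK HK; set I := [set X | _].
have IH : I H by split.
have [||M [[IM HM] _ Mmax]] :=
    @ACC_maximal [set X | I X /\ joined adj I H X] H acc.
- by move=> Y [[]].
- by split=> //; apply: joined_refl.
have [MK|MK] := pselect (M = K); first by rewrite -MK.
have [sM HM' MK'] := IM.
have [||N [[sN MN NK NM] _ Nmin]] :=
    @DCC_minimal [set X | [/\ sub X, M `<=` X, X `<=` K & X <> M]] K dcc.
- by move=> Y [].
- by split=> // /esym.
have IN : I N by split=> //; exact: subset_trans HM' MN.
exfalso; apply: (NM); apply: Mmax => //; split=> //.
apply: joined_trans HM _; apply: joined_edge => //; left; split=> //.
  by move=> /esym.
move=> L sL ML LN; have [->|LM] := pselect (L = M); first by left.
by right; apply: Nmin => //; split=> //; exact: subset_trans LN NK.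
Qed.

(** Differences of two natural exponents stand for integer exponents. *)
Definition cyc (g : G) : set G := [set x | exists m n, x = g ^+ m * g ^- n].

Lemma sub_cyc g : sub (cyc g).
Proof.
split.
- by exists 0%N, 0%N; rewrite invg1 mulg1.
- move=> _ _ [m [n ->]] [m' [n' ->]]; exists (m + m')%N, (n + n')%N.
  have gC : g ^- n * g ^+ m' = g ^+ m' * g ^- n.
    by apply/commute_sym/commuteV/commuteX2.
  by rewrite (addnC n) !expgnDr invgM !mulgA -(mulgA (g ^+ m)) gC !mulgA.
- move=> _ [m [n ->]]; exists n, m.
  by rewrite invgM invgK.
Qed.

Lemma cyc_id g : cyc g g.
Proof. by exists 1%N, 0%N; rewrite invg1 mulg1. Qed.

Lemma sub_expg H g n : sub H -> H g -> H (g ^+ n).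
Proof. by case=> H1 HM _ Hg; elim: n => // n IH; rewrite expgS; apply: HM. Qed.

Lemma cyc_min H g : sub H -> H g -> cyc g `<=` H.
Proof.
move=> sH Hg _ [m [n ->]]; have [_ HM HV] := sH.
by apply: HM; [|apply: HV]; apply: sub_expg.
Qed.

(** * Finiteness from the [K_{3,3}] obstruction *)

Definition outside_frattini g : set (set G) :=
  [set D | D g /\ exists2 C, maxsub C D & ~ C g].

Lemma outside_frattini_width g (D : 'I_3 -> set G) : ACC -> DCC -> planar ->
  (forall i, outside_frattini g (D i)) -> ~ (forall i j, i != j -> ~ D i `<=` D j).
Proof.
move=> acc dcc pl hD anti.
have hD' i : exists C, maxsub C (D i) /\ ~ C g by have [_ [C]] := hD i; exists C.
have [C hC] := choice hD'.
have DnD i j X : i != j -> D i `<=` X -> ~ X `<=` D j.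
  by move=> ij iX Xj; apply: (anti i j ij); exact: subset_trans iX Xj.
have sD i : sub (D i) by have [[_]] := hC i.
have Dg i : D i g by have [] := hD i.
(* The hubs are proper overgroups of some [D k], proper subgroups of some [D k] that contain [g],
   and subgroups missing [g]. Being an antichain keeps the first two apart and both away from the
   [D i]. *)
pose hub (j : 'I_3) : set (set G) := match val j with
  | 0%N => [set X | exists2 k, D k `<=` X & X <> D k]
  | 1%N => [set X | X g /\ exists2 k, X `<=` D k & X <> D k]
  | _ => [set X | ~ X g] end.
pose b (j : 'I_3) : set G := match val j with 0%N => setT | 1%N => cyc g | _ => [set 1] end.
pose Q i j := [set X | sub X /\ (X = D i \/ hub j X)].
apply: (@planar_K33 _ _ adj D b Q pl).
- by move=> i j X [].
- move=> i [[|[|[|//]]] lt]; rewrite /b /=.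
  + apply: joinedW (joined_interval acc dcc (sD i) sub_setT _) => //.
    move=> X [sX DX _]; split=> //.
    by have [->|XD] := pselect (X = D i); [left | right; exists i].
  + apply: joined_sym.
    apply: joinedW (joined_interval acc dcc (sub_cyc g) (sD i) _); last first.
      exact: cyc_min.
    move=> X [sX gX XD]; split=> //.
    have [->|XnD] := pselect (X = D i); [by left | right; split; last by exists i].
    by apply: gX; exact: cyc_id.
  + have [maxC Cg] := hC i; have [sC _ CD _ _] := maxC.
    apply: (@joined_trans _ _ _ _ (C i)).
      by apply: joined_edge; [split=> //; left | split=> //; right | right].
    apply: joined_sym; apply: joinedW (joined_interval acc dcc sub_set1 sC _).
      by move=> X [sX _ XC]; split=> //; right => /XC.
    by move=> _ ->; case: sC.
- move=> i k j l X ik jl [_ hX] [_ hX'].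
  have hubD i' j' : X = D i' -> ~ hub j' X.
    move=> ->; case: j' => [[|[|[|//]]] ?] /=; rewrite /hub /=.
    + by move=> [k' kD nD]; apply: (anti k' i') => //; apply/eqP => E; rewrite E in nD.
    + by move=> [_ [k' kD nD]]; apply: (anti i' k') => //; apply/eqP => E; rewrite E in nD.
    + by apply.
  have hub2 (j1 j2 : 'I_3) : (j1 < j2)%N -> hub j1 X -> ~ hub j2 X.
    case: j1 j2 => [[|[|[|//]]] ?] [[|[|[|//]]] ?] //= _; rewrite /hub /=.
    - move=> [k1 DX nD1] [_ [k2 XD nD2]]; have [E|k12] := eqVneq k1 k2.
        by subst k2; apply: nD1; apply/seteqP.
      exact: DnD k12 DX XD.
    - by move=> [k1 DX _]; apply; apply: DX.
    - by move=> [Xg _]; apply.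
  case: hX => [E|h]; case: hX' => [E'|h'].
  + by apply: (anti i k ik); rewrite -E -E'.
  + exact: hubD E h'.
  + exact: hubD E' h.
  + have : (j < l)%N || (l < j)%N by rewrite -neq_ltn.
    by case/orP => [jl'|lj]; [exact: hub2 jl' h h' | exact: hub2 lj h' h].
Qed.

Lemma finite_outside_frattini g : ACC -> DCC -> planar -> finite_set (outside_frattini g).
Proof.
move=> acc dcc pl; apply: finite_width2 => //.
  by move=> D [_ [C []]].
by move=> D; exact: outside_frattini_width.
Qed.

(** Keeping only finite [D] makes the union of these finitely many subgroups finite. *)
Definition outside_frattini_points g : set G :=
  [set x | exists D, [/\ outside_frattini g D, finite_set D & D x]].

Lemma finite_outside_frattini_points g : ACC -> DCC -> planar ->
  finite_set (outside_frattini_points g).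
Proof.
move=> acc dcc pl; apply: (@sub_finite_set _ _
  (\bigcup_(D in outside_frattini g `&` [set D | finite_set D]) D)).
  by move=> x [D [gD Dfin Dx]]; exists D.
apply: bigcup_finite; last by move=> D [].
by apply: sub_finite_set (finite_outside_frattini g acc dcc pl) => D [].
Qed.

(** The second alternative is the coset of [g^-1], which equals that of [g] since the square of [g]
    lies in [H]. *)
Lemma sub_index2 H g : sub H -> H (g * g) -> (forall x, H x -> H (x ^ g)) ->
  sub [set x | H x \/ H (x * g)].
Proof.
move=> [H1 HM HV] Hgg Hg; split=> [|x y|x] /=; first by left.
- move=> [Hx|Hx] [Hy|Hy].
  + by left; exact: HM.
  + by right; rewrite -mulgA; exact: HM.
  + by right; rewrite -mulgA (conjgC y) mulgA; apply: HM => //; exact: Hg.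
  + left; have -> : x * y = (x * g) * (y * g) ^ g * (g * g)^-1.
      by rewrite conjgE invgM !mulgA !mulgK.
    by apply: (HM); [apply: HM => //; exact: Hg | exact: HV].
- move=> [Hx|Hx]; first by left; exact: HV.
  right; have -> : x^-1 * g = (g * g) * ((x * g)^-1 ^ g).
    by rewrite conjgE invgM !mulgA !mulgK mulgV mul1g.
  by apply: HM => //; apply: Hg; exact: HV.
Qed.

(** [H] is maximal: a subgroup between that contains some [y] outside [H] also contains [y * g],
    which lies in [H], hence [g]. *)
Lemma index2_outside_frattini H g : sub H -> finite_set H -> ~ H g -> H (g * g) ->
  (forall x, H x -> H (x ^ g)) -> [set x | H x \/ H (x * g)] `<=` outside_frattini_points g.
Proof.
move=> sH Hfin nHg Hgg Hg x Dx; exists [set x | H x \/ H (x * g)]; split=> //.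
- split; first by right.
  exists H => //; split=> //.
  + exact: sub_index2.
  + by move=> y; left.
  + by move=> E; apply: nHg; rewrite E /=; right.
  + move=> L [L1 LM LV] HL LD; have [LH|] := pselect (L `<=` H).
      by left; apply/seteqP.
    move=> /existsNP[y /not_implyP[Ly nHy]]; right; apply/seteqP; split=> //.
    have Lg : L g.
      have Hyg : H (y * g) by have [] := LD y Ly.
      by rewrite -(mulKg y g); apply: LM; [exact: LV | exact: HL].
    move=> z [/HL //|/HL Lzg].
    by rewrite -(mulgK g z); apply: LM => //; exact: LV.
- apply: (@sub_finite_set _ _ (H `|` [set y * g^-1 | y in H])).
    by move=> y [Hy|Hy]; [left | right; exists (y * g) => //; rewrite mulgK].
  by rewrite finite_setU; split=> //; exact: finite_image.
Qed.

(** * Torsion and square roots *)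

Lemma expg_eq_torsion g m n : m != n -> g ^+ m = g ^+ n ->
  exists2 k, (0 < k)%N & g ^+ k = 1.
Proof.
wlog mn : m n / (m < n)%N => [hw|_ E].
  by rewrite neq_ltn => /orP[mn|nm] E; [apply: (hw m n)|apply: (hw n m)] => //;
     rewrite neq_ltn ?mn ?nm ?orbT.
by exists (n - m)%N; rewrite ?subn_gt0 // expgnFr ?(ltnW mn) // E mulgV.
Qed.

(** The chain of the [cyc (g ^+ (2 ^ n))] stabilizes. This equates two powers of [g] whose
    exponents, divided by [2 ^ N], are odd and even, hence different. *)
Lemma DCC_torsion g : DCC -> exists2 n, (0 < n)%N & g ^+ n = 1.
Proof.
move=> dcc; have [n|n|N /(_ N.+1 (leqnSn N)) E] := dcc (fun n => cyc (g ^+ (2 ^ n)%N)).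
- exact: sub_cyc.
- apply: cyc_min; first exact: sub_cyc.
  by rewrite /= expnS mulnC expgnA; apply: sub_expg; [exact: sub_cyc | exact: cyc_id].
have := cyc_id (g ^+ (2 ^ N)%N); rewrite -E => -[m [n]].
rewrite -!expgnA => E'.
apply: (@expg_eq_torsion _ (2 ^ N + 2 ^ N.+1 * n)%N (2 ^ N.+1 * m)%N).
  apply/eqP => E2; have : (2 ^ N * (1 + 2 * n) = 2 ^ N * (2 * m))%N.
    by move: E2; rewrite expnS; lia.
  by move/eqP; rewrite eqn_pmul2l ?expn_gt0 // => /eqP; lia.
by rewrite expgnDr {1}E' mulgVK.
Qed.

Lemma finite_cyc g : DCC -> finite_set (cyc g).
Proof.
move=> dcc; have [n n0 gn] := DCC_torsion g dcc.
apply: (@sub_finite_set _ _ [set g ^+ i | i in `I_n]); last exact: finite_image.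
(* The inverse of [g] is [g ^+ n.-1]. *)
move=> _ [a [b ->]]; exists ((a + b * n.-1) %% n)%N; first by rewrite /= ltn_mod.
have modE k : g ^+ (k %% n) = g ^+ k.
  by rewrite {2}(divn_eq k n) expgnDr mulnC expgnA gn expg1n mul1g.
rewrite modE expgnDr; congr (_ * _); apply/esym/mulg1_eq.
by rewrite -expgnDr -mulnS prednK // mulnC expgnA gn expg1n.
Qed.

Lemma sub_mul H K : sub H -> sub K -> (forall x y, H x -> K y -> commute x y) ->
  sub [set x * y | x in H & y in K].
Proof.
move=> [H1 HM HV] [K1 KM KV] HKC; split.
- by exists 1 => //; exists 1 => //; rewrite mulg1.
- move=> _ _ [x Hx [y Ky <-]] [x' Hx' [y' Ky' <-]].
  exists (x * x'); first exact: HM.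
  exists (y * y'); first exact: KM.
  by rewrite !mulgA -(mulgA x) (HKC x' y) // !mulgA.
- move=> _ [x Hx [y Ky <-]]; exists x^-1; first exact: HV.
  exists y^-1; first exact: KV.
  by rewrite invgM; apply: HKC; [exact: HV | exact: KV].
Qed.

Lemma sub_preim_conj H g : sub H -> sub [set x | H (x ^ g)].
Proof.
move=> [H1 HM HV]; split=> /=.
- by rewrite conj1g.
- by move=> x y Hx Hy; rewrite conjMg; exact: HM.
- by move=> x Hx; rewrite conjVg; exact: HV.
Qed.

Lemma sub_centralizer (A : set G) : sub [set x | forall y, A y -> commute y x].
Proof.
split=> [y _|x y hx hy z Az|x hx y Ay].
- exact: commute1.
- by apply: commuteM; [exact: hx | exact: hy].
- by apply: commuteV; exact: hx.
Qed.

Lemma cyc_commute x y u : commute x y -> cyc y u -> commute x u.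
Proof.
move=> xy; have: cyc y `<=` [set u | forall z, [set x] z -> commute z u].
  by apply: cyc_min; [exact: sub_centralizer | move=> _ ->].
by move=> /[apply]; exact.
Qed.

(* Two square roots [x], [y] of [z] generate, modulo the central subgroup
   [cyc z], a dihedral group with rotation [x * y]. *)
Lemma finite_sqrt z : ACC -> DCC -> planar -> finite_set [set y | y * y = z].
Proof.
move=> acc dcc pl; have zfin := finite_cyc z dcc.
have [[x [xx nx]]|nox] := pselect (exists x, x * x = z /\ ~ cyc z x); last first.
  apply: sub_finite_set zfin => y yy; apply: contrapT => ny.
  by apply: nox; exists y.
apply: (@sub_finite_set _ _ (cyc z `|` outside_frattini_points x)); last first.
  by rewrite finite_setU; split=> //; exact: finite_outside_frattini_points.
move=> y /= yy; have [zy|ny] := pselect (cyc z y); [by left | right].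
have xz : commute x z by rewrite -xx /commute mulgA.
have yz : commute y z by rewrite -yy /commute mulgA.
have zxy : commute z (x * y) by apply: commuteM; exact: commute_sym.
have sz := sub_cyc z; have [z1 zM zV] := sz.
pose C := [set u * v | u in cyc z & v in cyc (x * y)].
have HKC u v : cyc z u -> cyc (x * y) v -> commute u v.
  move=> zu; apply: cyc_commute; apply: commute_sym; apply: cyc_commute zu.
  exact: commute_sym.
have sC : sub C by apply: sub_mul => //; exact: sub_cyc.
have [C1 CM CV] := sC.
have zC u : cyc z u -> C u.
  by move=> zu; exists u => //; exists 1; [case: (sub_cyc (x * y)) | rewrite mulg1].
have xyC : C (x * y) by exists 1 => //; exists (x * y); [exact: cyc_id | rewrite mul1g].
(* Conjugation by [x] sends [x * y] to [y * x], so this makes [x] normalize [C]. *)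
have yxC : C (y * x).
  have -> : y * x = z * (x * y)^-1 * z.
    by rewrite -{1}yy -xx invgM !mulgA mulgK mulgVK.
  by apply: (CM); [apply: CM; [apply/zC/cyc_id | exact: CV] | apply/zC/cyc_id].
apply: (index2_outside_frattini sC).
- by apply: finite_image2 => //; exact: finite_cyc.
(* If [x] were in [C], it would commute with [x * y], whose square would lie in [cyc z]. Then [x] or
   [x * (x * y)], which is [z * y], would lie in [cyc z], against the choice of [x] and [y]. *)
- move=> [u zu [v xyv E]].
  have xC : commute x (x * y).
    have uC : commute u (x * y) by apply: HKC => //; exact: cyc_id.
    have vC : commute v (x * y).
      by apply/commute_sym; apply: cyc_commute xyv; exact: commute_refl.
    by rewrite -{1}E; apply/commute_sym/commuteM; exact: commute_sym.
  have z_sqr : cyc z (x * y * (x * y)).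
    by rewrite mulgA -xC mulgA xx -mulgA yy; apply: zM; exact: cyc_id.
  pose D := [set w | cyc z w \/ cyc z (w * (x * y))].
  have : D x.
    have sD : sub D.
      apply: sub_index2 => // w zw.
      rewrite (_ : w ^ (x * y) = w) // conjgE.
      have -> : w * (x * y) = x * y * w by apply: HKC => //; exact: cyc_id.
      by rewrite mulKg.
    have [_ DM _] := sD; rewrite -E; apply: DM; first by left.
    by apply: (cyc_min sD _ xyv); right.
  move=> [//|zxxy]; apply: ny.
  have -> : y = z^-1 * (x * (x * y)) by rewrite (mulgA x) xx mulKg.
  by apply: zM => //; apply: zV; exact: cyc_id.
- by rewrite xx; apply/zC/cyc_id.
- move=> _ [u zu [v xyv <-]]; rewrite conjMg; apply: CM.
    rewrite conjgE (_ : u * x = x * u); first by rewrite mulKg; exact: zC.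
    by apply/commute_sym; apply: cyc_commute zu.
  apply: (cyc_min (sub_preim_conj x sC) _ xyv) => /=.
  by rewrite conjgE mulgA mulKg.
- by right.
Qed.

(** * Elements of 2-power order *)

Lemma expg_odd_2power_eq1 g m k : odd m -> g ^+ m = 1 -> g ^+ (2 ^ k)%N = 1 -> g = 1.
Proof.
move=> m_odd; elim: k g => [|k IH] g gm //.
rewrite expnS expgnA => /IH g2.
have {}g2 : g ^+ 2 = 1 by apply: g2; rewrite expgnAC gm expg1n.
by rewrite -gm -(odd_double_half m) m_odd -mul2n expgnDr expgnA g2 expg1n mulg1.
Qed.

Definition order_2power : set G := [set x | exists k, x ^+ (2 ^ k)%N = 1].

(** Among the [z] with infinitely many iterated square roots, take one with [cyc z] maximal. Some
    square root [y] other than [z] again has infinitely many, so [cyc y = cyc z]. Then [y] is a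
    power of its own square, which forces [y = 1 = z]. *)
Lemma finite_order_2power : ACC -> DCC -> planar -> finite_set order_2power.
Proof.
move=> acc dcc pl; apply: contrapT => inf.
pose iter_root z := [set y | exists k, y ^+ (2 ^ k)%N = z].
have [||M [[z [z2 zinf <-]] _ zmax]] := @ACC_maximal
    [set H | exists z, [/\ order_2power z, ~ finite_set (iter_root z) & cyc z = H]]
    (cyc 1) acc.
- by move=> _ [z [_ _ <-]]; exact: sub_cyc.
- by exists 1; split=> //; exists 0%N.
apply: zinf; apply: (@sub_finite_set _ _ ([set z] `|`
    \bigcup_(y in [set y | y * y = z /\ y <> z]) iter_root y)).
  move=> w [k0 wk0].
  (* Minimality of the exponent keeps the last square root before [z] different from [z]. *)
  have [k /eqP wk kmin] := ex_minnP (ex_intro (fun k => w ^+ (2 ^ k)%N == z) k0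
    (introT eqP wk0)).
  case: k wk kmin => [<- _|k wk kmin]; [by left | right].
  exists (w ^+ (2 ^ k)%N); last by exists k.
  split; first by rewrite -expg2 -expgnA mulnC -expnS.
  by move=> /eqP /kmin; rewrite ltnn.
rewrite finite_setU; split; first exact: finite_set1.
apply: bigcup_finite => [|y [yy yz]].
  by apply: sub_finite_set (finite_sqrt z acc dcc pl) => y [].
apply: contrapT => yinf.
have [k zk] := z2.
have yk : y ^+ (2 ^ k.+1)%N = 1 by rewrite expnS expgnA expg2 yy.
have cycE : cyc y = cyc z.
  apply: zmax; first by exists y; split=> //; exists k.+1.
  apply: cyc_min; first exact: sub_cyc.
  by exists 2%N, 0%N; rewrite invg1 mulg1 expg2 yy.
have := cyc_id y; rewrite cycE => -[m [n E]].
have {}E : y ^+ (1 + 2 * n)%N = y ^+ (2 * m)%N.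
  by rewrite expgnDr expg1 !expgnA expg2 yy {1}E mulgVK.
suff y1 : y = 1 by apply: yz; rewrite -yy y1 mulg1.
have [mn|nm] := leqP (1 + 2 * n) (2 * m)%N.
- apply: (@expg_odd_2power_eq1 _ (2 * m - (1 + 2 * n))%N k.+1) => //; first by lia.
  by rewrite expgnFr // E mulgV.
- apply: (@expg_odd_2power_eq1 _ (1 + 2 * n - 2 * m)%N k.+1) => //; first by lia.
  by rewrite expgnFr ?(ltnW nm) // E mulgV.
Qed.

(** * The centralizer of an involution *)

Lemma finite_odd_centralizer g : ACC -> DCC -> planar -> g * g = 1 -> g <> 1 ->
  finite_set [set y | commute g y /\ exists2 m, odd m & y ^+ m = 1].
Proof.
move=> acc dcc pl gg g1.
apply: sub_finite_set (finite_outside_frattini_points g acc dcc pl) => y [gy [m m_odd ym]].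
have cyc1 := sub_cyc y; have [one_y _ _] := cyc1.
apply: (index2_outside_frattini cyc1); last by left; exact: cyc_id.
- exact: finite_cyc.
- move=> [a [b E]]; apply: g1; apply: (@expg_odd_2power_eq1 _ m 1%N) => //.
  rewrite E expgnFl; last exact: commuteX2.
  by rewrite !(expgnAC y _ m) ym !expg1n mulgV.
- by rewrite gg.
- move=> x yx; rewrite conjgE (_ : x * g = g * x) ?mulKg //.
  by apply/commute_sym; exact: cyc_commute yx.
Qed.

(** The fibres of [x] to [g ^ x] are cosets of the centralizer. *)
Lemma infinite_centralizer g : finite_set [set g ^ x | x in [set: G]] ->
  ~ finite_set [set: G] -> ~ finite_set [set x | commute g x].
Proof.
move=> class_fin Ginf cent_fin; apply: Ginf.
apply: (@sub_finite_set _ _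
  (\bigcup_(s in [set g ^ x | x in [set: G]]) [set x | g ^ x = s])).
  by move=> x _; exists (g ^ x) => //; exists x.
apply: bigcup_finite => // _ [x0 _ <-].
apply: (@sub_finite_set _ _ [set c * x0 | c in [set x | commute g x]]);
  last exact: finite_image.
move=> x /= E; exists (x * x0^-1); last by rewrite mulgVK.
have {}E : g ^ (x * x0^-1) = g by rewrite conjgM E conjgK.
by rewrite /= /commute conjgC E.
Qed.

(** Write [n] as [m * a] with [m] odd and [a] a power of 2. The Chinese remainder theorem gives [i]
    divisible by [a] and [j] divisible by [m] with sum 1 modulo [n]. *)
Lemma two_odd_decomposition g n : (0 < n)%N -> g ^+ n = 1 ->
  exists i j, [/\ g = g ^+ i * g ^+ j, (exists2 m, odd m & (g ^+ i) ^+ m = 1) &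
    order_2power (g ^+ j)].
Proof.
move=> n0 gn; have [m m_odd nE] := pfactor_coprime (isT : prime 2) n0.
set a := (2 ^ logn 2 n)%N in nE.
have am : coprime a m by rewrite /a coprimeXl.
pose i := chinese a m 0 1; pose j := chinese a m 1 0.
have gmod p q : p = q %[mod n] -> g ^+ p = g ^+ q.
  have modE k : g ^+ (k %% n) = g ^+ k.
    by rewrite {2}(divn_eq k n) expgnDr mulnC expgnA gn expg1n mul1g.
  by move=> pq; rewrite -modE pq modE.
have ai : (a %| i)%N by apply/eqP; rewrite chinese_modl // mod0n.
have mj : (m %| j)%N by apply/eqP; rewrite chinese_modr // mod0n.
exists i, j; split.
- rewrite -expgnDr -[LHS]expg1; apply: gmod; apply/eqP.
  rewrite nE mulnC chinese_remainder //; apply/andP; split; apply/eqP.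
    by rewrite -modnDm chinese_modl // chinese_modl // modnDm.
  by rewrite -modnDm chinese_modr // chinese_modr // modnDm.
- exists m; first by rewrite -coprime2n.
  rewrite -expgnA; have /dvdnP[k ->] := ai.
  by rewrite -mulnA [(a * m)%N]mulnC -nE mulnC expgnA gn expg1n.
- exists (logn 2 n); rewrite -/a -expgnA; have /dvdnP[k ->] := mj.
  by rewrite -mulnA -nE mulnC expgnA gn expg1n.
Qed.

Lemma planar_no_involution g : ACC -> DCC -> planar -> ~ finite_set [set: G] ->
  g * g = 1 -> g = 1.
Proof.
move=> acc dcc pl Ginf gg; apply: contrapT => g1.
apply: (@infinite_centralizer g) => //.
  (* The conjugates of [g] are square roots of 1. *)
  apply: sub_finite_set (finite_sqrt 1 acc dcc pl) => _ [x _ <-] /=.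
  by rewrite -conjMg gg conj1g.
apply: (@sub_finite_set _ _ [set x * y | x in
    [set y | commute g y /\ exists2 m, odd m & y ^+ m = 1] & y in order_2power]);
  last first.
  apply: finite_image2; last exact: finite_order_2power.
  exact: finite_odd_centralizer.
move=> x gx; have [n n0 xn] := DCC_torsion x dcc.
have [i [j [xE xi xj]]] := two_odd_decomposition n0 xn.
exists (x ^+ i); first by split=> //; exact: commuteX.
by exists (x ^+ j).
Qed.

End Groups.

Lemma infinite_type_setT (T : eqType) : infinite_type T -> ~ finite_set [set: T].
Proof.
move=> Tinf /finite_seqP[s sE]; apply: Tinf; exists s => y.
have : y \in s by have : [set: T] y by []; rewrite sE.
by elim: s {sE} => //= z s IH; rewrite in_cons => /orP[/eqP ->|/IH]; [left | right].
Qed.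

Theorem theorem3p12 (T : Type) (mul : T -> T -> T) (one : T) (inv : T -> T) :
  is_group mul one inv ->
  infinite_type T ->
  planar_group mul one inv ->
  subgroup_ACC mul one inv ->
  subgroup_DCC mul one inv ->
  forall x : T, mul x x = one -> x = one.
Proof.
move=> [mulA mul1 mulr1 mulV mulrV] Tinf pl acc dcc x xx.
(* Classical equality and choice make the bare type [T] a [groupType]. *)
pose C : choiceType := HB.pack T (gen_eqMixin T) (gen_choiceMixin T).
pose G : groupType := HB.pack T (gen_eqMixin T) (gen_choiceMixin T)
  (isGroup.Build C mulA mul1 mulr1 mulV mulrV).
exact: (@planar_no_involution G x acc dcc pl (@infinite_type_setT G Tinf) xx).
Qed.
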